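(* Let $G$ be a finite simple graph and let $d_1,\ldots,d_n$ be pairwise distinct edges of $G$. Then the following are equivalent. (1) Some permutation of $d_1,\ldots,d_n$ is a well ordered edge cover of $G$. (2) $G$ contains a strongly disjoint set of bouquets $\mathcal{B}$ with $E(\mathcal{B})=\{d_1,\ldots,d_n\}$; that is, there is a strongly disjoint set of bouquets $\mathcal{B}$ in $G$ with $V(\mathcal{B})=V(G)$ and $E(\mathcal{B})=\{d_1,\ldots,d_n\}$.
   Context: Edges of a graph $G$ are regarded as $2$-element subsets of $V(G)$. A set $D\subseteq E(G)$ is an edge cover of $G$ if every vertex of $G$ lies in some edge in $D$; it is minimal if no proper subset of it is an edge cover. A sequence $F_1,\ldots,F_k$ of edges of $G$ is a well ordered edge cover of $G$ if $\{F_1,\ldots,F_k\}$ is a minimal edge cover of $G$ and for every edge $H\in E(G)\setminus\{F_1,\ldots,F_k\}$ there exists $1\le i\leq k-1$ such that $F_i\subseteq H\cup F_{i+1}\cup F_{i+2}\cup\cdots\cup F_k$. A bouquet is a graph $B$ with $V(B)=\{r,z_1,\ldots,z_d\}$ and $E(B)=\{\{r,z_i\}\mid i=1,\ldots,d\}$, where $d\geq 1$ and $r,z_1,\ldots,z_d$ are distinct. A bouquet of $G$ is a bouquet that is a subgraph of $G$ (its vertex set and edge set are contained in those of $G$). For a set $\mathcal{B}=\{B_1,\ldots,B_q\}$ of bouquets of $G$ put $E(\mathcal{B})=\bigcup_{i=1}^q E(B_i)$ and $V(\mathcal{B})=\bigcup_{i=1}^q V(B_i)$. An induced matching in $G$ is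 a set $D$ of pairwise disjoint edges of $G$ such that the only edges of $G$ contained in $\bigcup_{e\in D}e$ are the elements of $D$. A set $\mathcal{B}=\{B_1,\ldots,B_q\}$ of bouquets of $G$ is disjoint if $V(B_k)\cap V(B_\ell)=\emptyset$ for all $k\neq\ell$; it is strongly disjoint if it is disjoint and for every $k=1,\ldots,q$ there exists $e_k\in E(B_k)$ such that $\{e_1,\ldots,e_q\}$ is an induced matching in $G$. $G$ contains a strongly disjoint set of bouquets if there is a strongly disjoint set of bouquets $\mathcal{B}$ of $G$ with $V(G)=V(\mathcal{B})$. *)

(* Defs.v *)
From HB Require Import structures.
From mathcomp Require Import all_boot.

Set Implicit Arguments.
Unset Strict Implicit.
Unset Printing Implicit Defensive.

(* A finite simple graph whose vertices are taken from a finite type T: a pair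
   (V, E) where every element of E is a 2-element subset of V. The vertex set
   is not required to be all of T, so that a subgraph of a graph is an object
   of the same type. *)
Record graph (T : finType) := Graph {
  graph_val : {set T} * {set {set T}};
  _ : [forall e in graph_val.2, (e \subset graph_val.1) && (#|e| == 2)]
}.

HB.instance Definition _ (T : finType) := [isSub for @graph_val T].
HB.instance Definition _ (T : finType) := [Finite of graph T by <:].

Section Graphs.
Variable T : finType.
Implicit Types (G B : graph T) (D : {set {set T}}) (F : seq {set T})
  (BB : {set graph T}).

Definition verts G : {set T} := (graph_val G).1.
Definition edges G : {set {set T}} := (graph_val G).2.

Definition subgraph B G : Prop :=
  verts B \subset verts G /\ edges B \subset edges G.

Definition edge_cover G D : bool :=
  (D \subset edges G) && [forall x in verts G, exists e in D, x \in e].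

Definition minimal_edge_cover G D : Prop := minset (edge_cover G) D.

(* Indices start from 0, so F_i is nth set0 F i.-1; the condition i <= k - 1
   becomes i.+1 < size F, and drop i.+1 F lists the edges after nth set0 F i. *)
Definition well_ordered_edge_cover G F : Prop :=
  minimal_edge_cover G [set:: F] /\
  forall H : {set T}, H \in edges G -> H \notin F ->
    exists2 i : nat, i.+1 < size F &
      nth set0 F i \subset H :|: \bigcup_(e <- drop i.+1 F) e.

Definition bouquet B : Prop :=
  exists (r : T) (Z : {set T}),
    [/\ Z != set0, r \notin Z, verts B = r |: Z &
        edges B = [set [set r; z] | z in Z]].

Definition bouquet_of G B : Prop := bouquet B /\ subgraph B G.

Definition bouquets_edges BB : {set {set T}} := \bigcup_(B in BB) edges B.
Definition bouquets_verts BB : {set T} := \bigcup_(B in BB) verts B.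

Definition induced_matching G D : Prop :=
  [/\ D \subset edges G,
      forall e f : {set T}, e \in D -> f \in D -> e != f -> [disjoint e & f] &
      forall e : {set T}, e \in edges G -> e \subset cover D -> e \in D].

Definition disjoint_bouquets G BB : Prop :=
  (forall B, B \in BB -> bouquet_of G B) /\
  (forall B B' : graph T, B \in BB -> B' \in BB -> B != B' ->
     [disjoint verts B & verts B']).

(* Only the values of c on BB matter. *)
Definition strongly_disjoint_bouquets G BB : Prop :=
  disjoint_bouquets G BB /\
  exists c : graph T -> {set T},
    (forall B, B \in BB -> c B \in edges B) /\
    induced_matching G [set c B | B in BB].

End Graphs.

(* Main.v *)
Require Import Defs.
From mathcomp Require Import all_boot.

(** A minimal edge cover D is a vertex-disjoint union of stars: minimality
    gives every edge of D an endpoint lying on no other edge of D.  Choosing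
    one such endpoint per edge yields a set W of leaves; the vertices outside
    W are the centres of the stars, and the edges of D at a centre form a
    bouquet.  These bouquets are disjoint and span the vertices, so the
    remaining question is which edge of each star serves in the induced
    matching.

    From a well ordered edge cover F, take in each star the edge that comes
    last in F.  An edge of F covered by these last edges has its leaf on one of
    them, hence is that one.  Suppose an edge H outside F is covered by them,
    and let F_i be contained in the union of H and the edges after F_i.  The
    leaf of F_i is on no later edge, so it is in H, hence on one of the last
    edges, which can only be F_i.  Thus F_i is the last edge of its star, and
    its centre is on no later edge either.  So H contains F_i, hence equals it:
    a contradiction.  This is [last_edges_induced].

    Conversely, given strongly disjoint bouquets with matching edges
    e_1, ..., e_q, list the other edges of the bouquets first and the e_k last.
    An edge H outside the list has an endpoint x outside the union of the e_k,
    because the matching is induced.  The endpoint x is a leaf of some bouquet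
    B_k, and its edge is contained in the union of H and e_k, since e_k
    contains the root of B_k and comes later.  This is
    [stems_last_well_ordered]. *)

Section BouquetCovers.
Set Implicit Arguments.
Unset Strict Implicit.
Unset Printing Implicit Defensive.

Variable T : finType.
Implicit Types (G B : graph T) (D : {set {set T}}) (F : seq {set T}).
Implicit Types (BB : {set graph T}) (W Z : {set T}).

(** * Graphs and bouquets *)

Lemma edge_sub G e : e \in edges G -> e \subset verts G.
Proof. by case: G => g gP /(forall_inP gP)/andP[]. Qed.

Lemma edge_card G e : e \in edges G -> #|e| = 2.
Proof. by case: G => g gP /(forall_inP gP)/andP[_ /eqP]. Qed.

Fact star_proof (r : T) Z :
  [forall e in [set [set r; z] | z in Z :\ r],
     (e \subset r |: Z) && (#|e| == 2)].
Proof.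
apply/forall_inP => _ /imsetP[z /setD1P[zr zZ] ->].
by rewrite cards2 [r == z]eq_sym zr setUS // sub1set.
Qed.

(** The centre is removed from Z in the edges only, so that a star is a graph
    for every r and Z. *)
Definition star r Z : graph T :=
  @Graph T (r |: Z, [set [set r; z] | z in Z :\ r]) (star_proof r Z).

Lemma bouquet_star r Z : r \notin Z -> Z != set0 -> bouquet (star r Z).
Proof.
move=> rZ Z0; exists r, Z; split => //; rewrite /edges /=.
by rewrite (setDidPl _) // disjoint_sym disjoints1.
Qed.

(** Bouquets as they are used below: an edge through a vertex x other than the
    root r can only be {r, x}. *)
Lemma bouquetP B : bouquet B -> exists r : T,
  [/\ forall e, e \in edges B -> r \in e,
      forall x, x \in verts B -> x != r -> [set r; x] \in edges B &
      forall e, e \in edges B -> exists2 z, z != r & e = [set r; z]].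
Proof.
move=> [r [Z [Z0 rZ eV eE]]]; exists r; rewrite eV eE; split.
- by move=> _ /imsetP[z _ ->]; rewrite set21.
- by move=> x /setU1P[->|xZ _]; [rewrite eqxx | exact: imset_f].
- by move=> _ /imsetP[z zZ ->]; exists z => //; apply: contraNneq rZ => <-.
Qed.

(** * Leaves of a minimal edge cover *)

(** D is a disjoint union of stars whose leaves are the vertices of [cover D]
    in W and whose centres are the others. *)
Definition leaf_set D W : Prop :=
  (forall e, e \in D ->
     exists r z, [/\ r \notin W, z \in W & e = [set r; z]]) /\
  (forall z e f, z \in W -> e \in D -> f \in D -> z \in e -> z \in f -> e = f).

Definition private D (e : {set T}) :=
  [set x in e | [forall f in D, (x \in f) ==> (f == e)]].

Lemma privateP D e f x : x \in private D e -> f \in D -> x \in f -> f = e.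
Proof. by rewrite inE => /andP[_ /forall_inP xP] /xP/implyP xf /xf/eqP. Qed.

(** Without a private vertex, e could be dropped from the cover. *)
Lemma minimal_cover_private G D e :
  minimal_edge_cover G D -> e \in D -> private D e != set0.
Proof.
move=> /minsetP[/andP[DG /forall_inP Dcov] Dmin] eD; apply/negP => /eqP pr0.
suff /Dmin DDe : edge_cover G (D :\ e).
  by have := eD; rewrite -DDe ?subD1set // setD11.
apply/andP; split; first exact: subset_trans (subD1set _ _) DG.
apply/forall_inP => x /Dcov/exists_inP[f fD xf]; apply/exists_inP.
have [fe|fe] := eqVneq f e; last by exists f; rewrite // !inE fe.
have : x \notin private D e by rewrite pr0 inE.
rewrite inE -fe xf /= => /forall_inPn[g gD].
by rewrite negb_imply => /andP[xg gf]; exists g; rewrite // !inE gf.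
Qed.

(** On an isolated edge of D both endpoints are private, so one of them has to
    be picked. *)
Lemma minimal_cover_leaf_set G D :
  minimal_edge_cover G D -> exists W, leaf_set D W.
Proof.
move=> Dmin; have /minsetp/andP[/subsetP DG _] := Dmin.
pose leaf e := [pick x in private D e].
have leafP e x : leaf e = Some x -> x \in private D e.
  by rewrite /leaf; case: pickP => // y yP [<-].
exists [set x | [exists e in D, leaf e == Some x]]; split; last first.
  move=> z e f; rewrite inE => /exists_inP[g gD /eqP/leafP zg] eD fD ze zf.
  by rewrite (privateP zg eD ze) (privateP zg fD zf).
move=> e eD.
have [z lz] : exists z, leaf e = Some z.
  have /set0Pn[y yP] := minimal_cover_private Dmin eD.
  by rewrite /leaf; case: pickP => [z _|/(_ y)]; [exists z | rewrite yP].
have ze : z \in e by move/leafP: lz; rewrite inE => /andP[].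
have /cards1P[r er] : #|e :\ z| == 1.
  by have := edge_card (DG e eD); rewrite (cardsD1 z) ze => /eqP.
exists r, z; split.
- rewrite inE; apply/exists_inPn => f fD; apply/eqP => lr.
  have /setD1P[rz re] : r \in e :\ z by rewrite er set11.
  have ef := privateP (leafP _ _ lr) eD re.
  by move: lr; rewrite -ef lz => -[zr]; rewrite zr eqxx in rz.
- by rewrite inE; apply/exists_inP; exists e => //; apply/eqP.
- by rewrite setUC -er setD1K.
Qed.

(** * The bouquets of a minimal edge cover *)

Definition leaves_at D W r := [set z in W | [set r; z] \in D].

Definition cover_star D W r := star r (leaves_at D W r).

Definition cover_stars D W := [set cover_star D W r | r in cover D :\: W].

Section CoverStars.
Variables (G : graph T) (D : {set {set T}}) (W : {set T}).
Hypotheses (Dmin : minimal_edge_cover G D) (DW : leaf_set D W).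

Lemma leaf_set_edge e r :
  e \in D -> r \notin W -> r \in e -> exists2 z, z \in W & e = [set r; z].
Proof.
move=> eD rW; have [r' [z [r'W zW ->]]] := DW.1 e eD.
by case/set2P=> rE; [exists z; rewrite // rE | rewrite rE zW in rW].
Qed.

Lemma centre_uniq e r s :
  e \in D -> r \notin W -> s \notin W -> r \in e -> s \in e -> r = s.
Proof.
move=> eD rW sW re; have [z zW ->] := leaf_set_edge eD rW re.
by case/set2P=> // sz; rewrite sz zW in sW.
Qed.

Lemma cover_star_edges r :
  r \notin W -> edges (cover_star D W r) = [set e in D | r \in e].
Proof.
move=> rW; apply/setP=> e; rewrite inE; apply/imsetP/andP.
  by move=> [z /setD1P[_]]; rewrite inE => /andP[_ eD] ->; rewrite set21.
move=> [eD re]; have [z zW ez] := leaf_set_edge eD rW re.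
exists z => //; rewrite !inE -ez eD zW !andbT.
by apply: contraNneq rW => <-.
Qed.

Lemma cover_star_vertsP r x : r \in cover D :\: W ->
  reflect (exists e, [/\ e \in D, r \in e & x \in e])
          (x \in verts (cover_star D W r)).
Proof.
move=> rC; have /setDP[rD rW] := rC; apply: (iffP idP).
  case/setU1P=> [->|]; first by have /bigcupP[e] := rD; exists e.
  by rewrite inE => /andP[_ fD]; exists [set r; x]; rewrite set21 set22.
move=> [f [fD rf]]; have [z zW fz] := leaf_set_edge fD rW rf.
rewrite fz => /set2P[->|->]; first exact: setU11.
by apply/setU1P; right; rewrite inE zW -fz.
Qed.

Lemma cover_star_disjoint r s x :
    r \in cover D :\: W -> s \in cover D :\: W ->
  x \in verts (cover_star D W r) -> x \in verts (cover_star D W s) -> r = s.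
Proof.
move=> rC sC /(cover_star_vertsP _ rC)[e [eD re xe]].
move=> /(cover_star_vertsP _ sC)[f [fD sf xf]].
have [/setDP[_ rW] /setDP[_ sW]] := (rC, sC).
have [xW|xW] := boolP (x \in W).
  by rewrite -(DW.2 _ _ _ xW eD fD xe xf) in sf; apply: centre_uniq sf.
by rewrite (centre_uniq eD rW xW re xe) (centre_uniq fD sW xW sf xf).
Qed.

Lemma cover_edges : D \subset edges G.
Proof. by have /minsetp/andP[] := Dmin. Qed.

Lemma cover_verts : cover D = verts G.
Proof.
have /minsetp/andP[/subsetP DG /forall_inP Dcov] := Dmin.
apply/setP=> x; apply/bigcupP/idP => [[e /DG/edge_sub/subsetP]|]; first exact.
by move=> /Dcov/exists_inP[e]; exists e.
Qed.

Lemma cover_star_bouquet r :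
  r \in cover D :\: W -> bouquet_of G (cover_star D W r).
Proof.
move=> rC; have /setDP[/bigcupP[e eD re] rW] := rC; split.
  apply: bouquet_star; first by rewrite inE (negPf rW).
  have [z zW ez] := leaf_set_edge eD rW re.
  by apply/set0Pn; exists z; rewrite inE zW -ez.
split; last first.
  rewrite cover_star_edges //; apply: subset_trans cover_edges.
  by apply/subsetP=> f; rewrite inE => /andP[].
apply/subsetP=> x /(cover_star_vertsP _ rC)[f [fD _]].
exact/subsetP/edge_sub/(subsetP cover_edges).
Qed.

Lemma edge_cover_star e : e \in D ->
  exists r, [/\ r \in cover D :\: W, r \in e & e \in edges (cover_star D W r)].
Proof.
move=> eD; have [r [z [rW _ ez]]] := DW.1 e eD.
have re : r \in e by rewrite ez set21.
exists r; rewrite cover_star_edges // !inE eD re rW; split => //.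
by apply/bigcupP; exists e.
Qed.

Lemma cover_stars_disjoint : disjoint_bouquets G (cover_stars D W).
Proof.
split=> [B /imsetP[r rC ->]|B C /imsetP[r rC ->] /imsetP[s sC ->] rs].
  exact: cover_star_bouquet.
apply: contraNT rs => /pred0Pn[x /andP[xr xs]].
by rewrite (cover_star_disjoint rC sC xr xs).
Qed.

Lemma cover_stars_edges : bouquets_edges (cover_stars D W) = D.
Proof.
apply/setP=> e; apply/bigcupP/idP => [[_ /imsetP[r /setDP[_ rW] ->]]|eD].
  by rewrite cover_star_edges // inE => /andP[].
have [r [rC _ er]] := edge_cover_star eD.
by exists (cover_star D W r) => //; apply: imset_f.
Qed.

Lemma cover_stars_verts : bouquets_verts (cover_stars D W) = verts G.
Proof.
rewrite -cover_verts; apply/setP=> x; apply/bigcupP/bigcupP.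
  by move=> [_ /imsetP[r rC ->] /(cover_star_vertsP _ rC)[e [? _ ?]]]; exists e.
move=> [e eD xe]; have [r [rC re _]] := edge_cover_star eD.
exists (cover_star D W r); first exact: imset_f.
by apply/(cover_star_vertsP _ rC); exists e.
Qed.

End CoverStars.

(** * From a well ordered edge cover to an induced matching *)

Lemma in_drop (F : seq {set T}) i e :
  uniq F -> e \in drop i F -> e \in F /\ i <= index e F.
Proof.
move=> uF eF; have eF' := mem_drop eF; split => //.
rewrite leqNgt; apply/negP => ei.
move: uF; rewrite -(cat_take_drop i F) cat_uniq => /and3P[_ /hasPn/(_ e eF)].
by rewrite /= in_take // ei.
Qed.

Definition last_edge F B e : Prop :=
  e \in edges B /\ forall f, f \in edges B -> index f F <= index e F.

Lemma bouquet_last_edge F B : bouquet B -> exists e, last_edge F B e.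
Proof.
move=> [r [Z [/set0Pn[z zZ] _ _ eE]]].
have e0 : [set r; z] \in edges B by rewrite eE; apply: imset_f.
by case: (arg_maxnP (fun e => index e F) e0) => e eB emax; exists e.
Qed.

(** A vertex of the star at r is a leaf, on a single edge of F, or r itself, on
    no edge of F after the chosen one.  So an edge F_i whose leaf is on a chosen
    edge shares no vertex with later edges, and F_i can be contained in the
    union of H and the later edges only by being H. *)
Lemma last_edges_induced G F W (c : graph T -> {set T}) :
    uniq F -> well_ordered_edge_cover G F -> leaf_set [set:: F] W ->
    (forall B, B \in cover_stars [set:: F] W -> last_edge F B (c B)) ->
  induced_matching G [set c B | B in cover_stars [set:: F] W].
Proof.
set D := [set:: F] => uF [Dmin Ford] DW cP.
have DG := subsetP (cover_edges Dmin).
have inD e : (e \in D) = (e \in F) by rewrite inE.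
(* The matching edge of the star at r is an edge of D at r, beyond which F has
   no edge at r. *)
have cE r : r \in cover D :\: W -> let e := c (cover_star D W r) in
    [/\ e \in D, r \in e &
        forall f, f \in D -> r \in f -> index f F <= index e F].
  move=> rC; have /setDP[_ rW] := rC.
  have [] := cP _ (imset_f (cover_star D W) rC); rewrite cover_star_edges //.
  rewrite inE => /andP[eD re] eM; split => // f fD rf.
  by apply: eM; rewrite inE fD.
have leafE e z : e \in D -> z \in W -> z \in e ->
    z \in cover [set c B | B in cover_stars D W] ->
    exists2 r, r \in cover D :\: W & e = c (cover_star D W r).
  move=> eD zW ze /bigcupP[_ /imsetP[_ /imsetP[r rC ->] ->] zc].
  have [cD _ _] := cE r rC; exists r => //.
  exact: DW.2 zW eD cD ze zc.
split.
- apply/subsetP=> _ /imsetP[_ /imsetP[r rC ->] ->].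
  by have [/DG] := cE r rC.
- move=> _ _ /imsetP[_ /imsetP[r rC ->] ->] /imsetP[_ /imsetP[s sC ->] ->] rs.
  have [[eD re _] [fD sf _]] := (cE r rC, cE s sC).
  apply: contraNT rs => /pred0Pn[x /andP[xe xf]].
  have -> // : r = s.
  apply: (cover_star_disjoint DW rC sC (x := x)).
    by apply/(cover_star_vertsP DW _ rC); exists (c (cover_star D W r)).
  by apply/(cover_star_vertsP DW _ sC); exists (c (cover_star D W s)).
move=> H HG /subsetP Hsub; have [HF|HF] := boolP (H \in F).
  have HD : H \in D by rewrite inD.
  have [r [z [_ zW Hz]]] := DW.1 H HD.
  have zH : z \in H by rewrite Hz set22.
  have [s sC ->] := leafE H z HD zW zH (Hsub z zH).
  exact/imset_f/imset_f.
have [i iF /subsetP Fi] := Ford H HG HF; exfalso.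
have {}iF : i < size F by apply: ltnW.
set e := nth set0 F i in Fi; have eD : e \in D by rewrite inD mem_nth.
have ie : index e F = i by rewrite index_uniq.
(* An endpoint of e = F_i outside H is on an edge that comes after e in F. *)
have later x : x \in e -> x \notin H ->
    exists f, [/\ f \in D, x \in f & i < index f F].
  move=> /Fi/setUP[->//|]; rewrite bigcup_seq => /bigcupP[f fd xf] _.
  by have [fF fi] := in_drop uF fd; exists f; rewrite inD.
have [r [z [rW zW ez]]] := DW.1 e eD.
have [re ze] : r \in e /\ z \in e by rewrite ez set21 set22.
have zH : z \in H.
  apply/negPn/negP => /(later z ze)[f [fD zf]].
  by rewrite -(DW.2 _ _ _ zW eD fD ze zf) ie ltnn.
have [s sC es] := leafE e z eD zW ze (Hsub z zH).
have [_ se smax] := cE s sC; rewrite -es in se smax.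
have rs : r = s.
  by have /setDP[_ sW] := sC; apply: (centre_uniq DW eD).
have rH : r \in H.
  apply/negPn/negP => /(later r re)[f [fD rf]]; rewrite -ie.
  by rewrite ltnNge smax // -rs.
move: HF; rewrite -inD; have -> // : H = e; last by rewrite eD.
apply/esym/eqP; rewrite eqEcard (edge_card HG) (edge_card (DG e eD)) andbT.
by rewrite ez subUset !sub1set rH zH.
Qed.

(** * From strongly disjoint bouquets to a well ordered edge cover *)

Lemma disjoint_bouquets_eq G BB B C x : disjoint_bouquets G BB ->
  B \in BB -> C \in BB -> x \in verts B -> x \in verts C -> B = C.
Proof.
move=> [_ dis] BB_B BB_C xB xC; apply: contraTeq xC => BC.
by rewrite (disjointFr (dis B C BB_B BB_C BC) xB).
Qed.

(** The non-root endpoint of an edge of a bouquet is on no other edge, so no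
    edge can be dropped. *)
Lemma disjoint_bouquets_minimal_cover G BB :
    disjoint_bouquets G BB -> bouquets_verts BB = verts G ->
  minimal_edge_cover G (bouquets_edges BB).
Proof.
move=> dBB vBB; have [bouq _] := dBB; apply/minsetP; split.
  apply/andP; split.
    by apply/bigcupsP=> B /bouq[_ []].
  apply/forall_inP=> x; rewrite -vBB => /bigcupP[B BB_B xB]; apply/exists_inP.
  have [[r [Z [/set0Pn[z zZ] _ eV eE]]] _] := bouq B BB_B.
  have [y yZ xy] : exists2 y, y \in Z & x \in [set r; y].
    move: xB; rewrite eV => /setU1P[->|xZ]; first by exists z; rewrite ?set21.
    by exists x; rewrite ?set22.
  exists [set r; y] => //; apply/bigcupP; exists B => //.
  by rewrite eE; apply: imset_f.
move=> D /andP[_ /forall_inP Dcov] DE; apply/eqP; rewrite eqEsubset DE /=.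
apply/subsetP=> e /bigcupP[B BB_B eB].
have [r [_ _ rZ]] := bouquetP (bouq B BB_B).1.
have [z zr ez] := rZ e eB.
have zB : z \in verts B by apply: (subsetP (edge_sub eB)); rewrite ez set22.
have /Dcov/exists_inP[f fD zf] : z \in verts G.
  by rewrite -vBB; apply/bigcupP; exists B.
have /bigcupP[C BB_C fC] := subsetP DE f fD.
have zC : z \in verts C by apply: (subsetP (edge_sub fC)).
rewrite (disjoint_bouquets_eq dBB BB_C BB_B zC zB) in fC.
have [y _ fy] := rZ f fC; move: zf; rewrite fy => /set2P[zE|zy].
  by rewrite zE eqxx in zr.
by rewrite ez zy -fy.
Qed.

(** The matching edges come last because each of them contains the root of its
    bouquet: after any other edge of the bouquet only the leaf of that edge
    remains to be supplied by H. *)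
Lemma stems_last_well_ordered G BB (c : graph T -> {set T}) (d : seq {set T}) :
    let M := [set c B | B in BB] in
    disjoint_bouquets G BB -> bouquets_verts BB = verts G ->
    bouquets_edges BB = [set:: d] ->
    (forall B, B \in BB -> c B \in edges B) -> induced_matching G M ->
  well_ordered_edge_cover G ([seq e <- d | e \notin M] ++ [seq e <- d | e \in M]).
Proof.
move=> M dBB vBB eBB cP [_ _ Mind]; set F := _ ++ _.
have memF e : (e \in F) = (e \in d).
  by rewrite mem_cat !mem_filter -andb_orl orNb.
have inBB e : e \in bouquets_edges BB -> e \in d by rewrite eBB inE.
split.
  have -> : [set:: F] = bouquets_edges BB.
    by rewrite eBB; apply/setP=> e; rewrite !inE memF.
  exact: disjoint_bouquets_minimal_cover.
move=> H HG; rewrite memF => Hd.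
(* An endpoint of H off the matching is not the root of its bouquet B, as the
   root is on c B. *)
have /subsetPn[x xH xM] : ~~ (H \subset cover M).
  apply: contra Hd => /(Mind H HG)/imsetP[B BB_B ->].
  by apply/inBB/bigcupP; exists B => //; apply: cP.
have /bigcupP[B BB_B xB] : x \in bouquets_verts BB.
  by rewrite vBB (subsetP (edge_sub HG)).
have cM : c B \in M by apply: imset_f.
have [r [rE rV _]] := bouquetP (dBB.1 B BB_B).1.
have rc : r \in c B by apply/rE/cP.
have coverM e y : e \in M -> y \in e -> y \in cover M.
  by move=> eM ye; apply/bigcupP; exists e.
have xr : x != r by apply: contraNneq xM => ->; apply: coverM rc.
have eB := rV x xB xr; set e := [set r; x] in eB.
have eM : e \notin M by apply: contra xM => eM; apply: coverM eM _; apply: set22.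
have ed : e \in d by apply/inBB/bigcupP; exists B.
have cd : c B \in d by apply/inBB/bigcupP; exists B => //; apply: cP.
have e1 : e \in [seq e <- d | e \notin M] by rewrite mem_filter eM.
have c2 : c B \in [seq e <- d | e \in M] by rewrite mem_filter cM.
have eF : index e F < size [seq e <- d | e \notin M].
  by rewrite index_cat e1 index_mem.
exists (index e F).
  rewrite size_cat -addn1 leq_add // -?has_predT.
  by case: [seq _ <- _ | _] c2.
rewrite nth_index ?memF // subUset !sub1set; apply/andP; split; last first.
  by rewrite inE xH.
apply/setUP; right; rewrite bigcup_seq; apply/bigcupP; exists (c B) => //.
(* e is in the first part of the list, so dropping up to e keeps the second
   part, where c B is. *)
rewrite drop_cat; case: ltnP => [_|sz]; first by rewrite mem_cat c2 orbT.
by have -> : (index e F).+1 - size [seq e <- d | e \notin M] = 0;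
  [apply/eqP; rewrite subn_eq0 | rewrite drop0].
Qed.

End BouquetCovers.

Theorem proposition4p3 (T : finType) (G : graph T) (d : seq {set T})
    (d_edges : {subset d <= edges G}) (d_uniq : uniq d) :
  (exists F : seq {set T}, perm_eq F d /\ well_ordered_edge_cover G F)
  <->
  (exists BB : {set graph T},
     [/\ strongly_disjoint_bouquets G BB,
         bouquets_verts BB = verts G &
         bouquets_edges BB = [set:: d]]).
Proof.
split=> [[F [Fd Ford]]|[BB [[dBB [c [cP cM]]] vBB eBB]]]; last first.
  set M := [set c B | B in BB] in cM.
  exists ([seq e <- d | e \notin M] ++ [seq e <- d | e \in M]); split.
    by rewrite perm_catC perm_filterC.
  exact: stems_last_well_ordered.
have [Fmin _] := Ford; have [W DW] := minimal_cover_leaf_set Fmin.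
have dBB := cover_stars_disjoint Fmin DW.
have [c cP] : exists c : graph T -> {set T}, forall B,
    B \in cover_stars [set:: F] W -> last_edge F B (c B).
  apply: (@fin_all_exists (graph T) (fun=> {set T})
    (fun B e => B \in _ -> last_edge F B e)) => B.
  have [BC|_] := boolP (B \in cover_stars _ _); last by exists set0.
  by have [e eP] := bouquet_last_edge F (dBB.1 B BC).1; exists e.
exists (cover_stars [set:: F] W); split.
- split=> //; exists c; split=> [B /cP[]//|].
  by apply: last_edges_induced; rewrite // (perm_uniq Fd).
- exact: cover_stars_verts Fmin DW.
- rewrite (cover_stars_edges DW).
  by apply/setP=> e; rewrite !inE (perm_mem Fd).
Qed.
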